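(* For every integer $d$, there exist integers $D$ and $\Gamma$ such that for any two (not necessarily finite) plane $c$-trees $T$ and $T'$, if for each $D$-Hintikka type the trees $T$ and $T'$ have the same number of nodes of this type or the number of nodes of this type is at least $\Gamma$ in both $T$ and $T'$, then the sets of $d$-sentences satisfied by $T$ and $T'$ are the same.
   Context: Plane $c$-trees: rooted trees (possibly infinite) in the signature consisting of binary relations $\mathbf{parnt}(x,y)$ ($x$ is a child of $y$), $\mathbf{succ}(x,y)$ ($x,y$ are consecutive children of the same node in the given linear order of children), and countably many constants $c_1,c_2,\dots$, some of which are interpreted by pairwise distinct nodes. A $d$-formula is a first order formula of quantifier depth at most $d$ using no constants other than $c_1,\dots,c_d$; a $d$-sentence is a $d$-formula without free variables. A first order formula is local if every quantifier is restricted to neighbors (via $\mathbf{parnt}$ or $\mathbf{succ}$) of some variable, i.e. has the form $\forall_z x$ or $\exists_z x$ with $x$ a neighbor of $z$. The $D$-Hintikka type of a node $v$ of $T$ is the set of local $D$-formulas with one free variable (up to equivalence) satisfied by $v$ in $T$. *)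

(* Defs.v *)
From mathcomp Require Import all_boot.
From mathcomp Require Import all_classical.

Set Implicit Arguments.
Unset Strict Implicit.
Unset Printing Implicit Defensive.

Local Open Scope classical_set_scope.

(* [parent_iter] says that every node is at finite distance from the root;    *)
(* with [parent_root] it makes the root the only node without a parent and    *)
(* excludes cycles. [sib_lt x y] holds only between children of the same      *)
(* node; there it is an arbitrary strict linear order.                        *)
Record plane_tree : Type := PlaneTree {
  node :> Type;
  troot : node;
  parent : node -> option node;
  parent_root : parent troot = None;
  parent_iter : forall x, exists n, iter n (obind parent) (Some x) = Some troot;
  sib_lt : node -> node -> Prop;
  sib_lt_sibling : forall x y, sib_lt x y ->
    exists p, parent x = Some p /\ parent y = Some p;
  sib_lt_irr : forall x, ~ sib_lt x x;
  sib_lt_trans : forall x y z, sib_lt x y -> sib_lt y z -> sib_lt x z;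
  sib_lt_total : forall p x y, parent x = Some p -> parent y = Some p ->
    x <> y -> sib_lt x y \/ sib_lt y x
}.

Definition parnt (T : plane_tree) (x y : T) : Prop := parent x = Some y.

Definition succ (T : plane_tree) (x y : T) : Prop :=
  sib_lt x y /\ ~ (exists z, sib_lt x z /\ sib_lt z y).

(* [const i] is the interpretation of the constant c_(i+1), [None] if that    *)
(* constant is not interpreted.                                               *)
Record plane_ctree : Type := PlaneCTree {
  ptree :> plane_tree;
  const : nat -> option ptree;
  const_inj : forall i j v, const i = Some v -> const j = Some v -> i = j
}.

Inductive term (n : nat) : Type :=
  | Var of 'I_n
  | Cst of nat.
Arguments Cst {n}.

(* First order formulas whose free variables are among the n variables 'I_n.  *)
(* Variables are de Bruijn indices: under a quantifier, [ord0] is the bound   *)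
(* variable and [lift ord0 i] is the outer variable i.                        *)
Inductive formula (n : nat) : Type :=
  | Bot
  | Equ of term n & term n
  | Par of term n & term n
  | Suc of term n & term n
  | And of formula n & formula n
  | Or of formula n & formula n
  | Imp of formula n & formula n
  | All of formula n.+1
  | Exi of formula n.+1.
Arguments Bot {n}.

Definition env_cons (V : Type) (n : nat) (v : V) (e : 'I_n -> V) :
    'I_n.+1 -> V :=
  fun i => if unlift ord0 i is Some j then e j else v.

Definition eval (T : plane_ctree) (n : nat) (e : 'I_n -> T) (t : term n) :
    option T :=
  match t with
  | Var i => Some (e i)
  | Cst i => const T i
  end.

(* An atomic formula mentioning an uninterpreted constant is false. *)
Definition holds2 (V : Type) (r : V -> V -> Prop) (a b : option V) : Prop :=
  match a, b with
  | Some x, Some y => r x y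
  | _, _ => False
  end.

Fixpoint sat (T : plane_ctree) (n : nat) (phi : formula n) (e : 'I_n -> T) :
    Prop :=
  match phi with
  | Bot => False
  | Equ t u => holds2 eq (eval e t) (eval e u)
  | Par t u => holds2 (@parnt T) (eval e t) (eval e u)
  | Suc t u => holds2 (@succ T) (eval e t) (eval e u)
  | And f g => sat f e /\ sat g e
  | Or f g => sat f e \/ sat g e
  | Imp f g => sat f e -> sat g e
  | All f => forall v : T, sat f (env_cons v e)
  | Exi f => exists v : T, sat f (env_cons v e)
  end.

Fixpoint qdepth (n : nat) (phi : formula n) : nat :=
  match phi with
  | Bot | Equ _ _ | Par _ _ | Suc _ _ => 0
  | And f g | Or f g | Imp f g => maxn (qdepth f) (qdepth g)
  | All f | Exi f => (qdepth f).+1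
  end.

Definition term_below (d n : nat) (t : term n) : bool :=
  if t is Cst i then i < d else true.

Fixpoint csts_below (d n : nat) (phi : formula n) : bool :=
  match phi with
  | Bot => true
  | Equ t u | Par t u | Suc t u => term_below d t && term_below d u
  | And f g | Or f g | Imp f g => csts_below d f && csts_below d g
  | All f | Exi f => csts_below d f
  end.

Definition d_formula (d n : nat) (phi : formula n) : bool :=
  (qdepth phi <= d) && csts_below d phi.

(* "The newly bound variable is a neighbor of the outer variable z." *)
Definition nbr (n : nat) (z : 'I_n) : formula n.+1 :=
  let x := Var (@ord0 n) in
  let z' := Var (lift ord0 z) in
  Or (Or (Par x z') (Par z' x)) (Or (Suc x z') (Suc z' x)).

Definition AllNbr (n : nat) (z : 'I_n) (phi : formula n.+1) : formula n :=
  All (Imp (nbr z) phi).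

Definition ExiNbr (n : nat) (z : 'I_n) (phi : formula n.+1) : formula n :=
  Exi (And (nbr z) phi).

Inductive local : forall n : nat, formula n -> Prop :=
  | local_Bot n : local (@Bot n)
  | local_Equ n (t u : term n) : local (Equ t u)
  | local_Par n (t u : term n) : local (Par t u)
  | local_Suc n (t u : term n) : local (Suc t u)
  | local_And n (f g : formula n) : local f -> local g -> local (And f g)
  | local_Or n (f g : formula n) : local f -> local g -> local (Or f g)
  | local_Imp n (f g : formula n) : local f -> local g -> local (Imp f g)
  | local_AllNbr n (z : 'I_n) (f : formula n.+1) :
      local f -> local (AllNbr z f)
  | local_ExiNbr n (z : 'I_n) (f : formula n.+1) :
      local f -> local (ExiNbr z f).

(* The set is closed under equivalence of local D-formulas, so equality of    *)
(* these sets is equality of types up to equivalence.                         *)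
Definition hintikka_type (D : nat) (T : plane_ctree) (v : T) :
    set (formula 1) :=
  [set phi | [/\ local phi, d_formula D phi & sat phi (fun _ : 'I_1 => v)]].

Definition nodes_of_type (D : nat) (T : plane_ctree) (tau : set (formula 1)) :
    set T :=
  [set v | hintikka_type D v = tau].
Arguments nodes_of_type D T tau : clear implicits.

Definition models (T : plane_ctree) (phi : formula 0) : Prop :=
  forall e : 'I_0 -> T, sat phi e.

Definition d_sentences (d : nat) (T : plane_ctree) : set (formula 0) :=
  [set phi | d_formula d phi /\ models T phi].

(* Main.v *)
Require Import Defs.
From mathcomp Require Import all_boot zify.
From mathcomp Require Import all_classical.

Set Implicit Arguments.
Unset Strict Implicit.
Unset Printing Implicit Defensive.

Local Open Scope classical_set_scope.
Local Open Scope card_scope.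
Local Open Scope relation_scope.

(* Duplicator wins the d-round Ehrenfeucht-Fraisse game by keeping the        *)
(* pebbled tuples equivalent for a local back-and-forth game, whose number of *)
(* rounds shrinks fast as the main game goes on. A move near the pebbles is   *)
(* answered in the local game; for a move a far from the pebbles it is enough *)
(* to find a node of the same local type far from the pebbles of the other    *)
(* tree. As degrees are unbounded, abundance of nodes of that type does not   *)
(* suffice: all of them may lie close to one pebble. One therefore counts the *)
(* nodes with the local type of the h-th ancestor of a: two nodes at distance *)
(* at most h share an ancestor at most h levels up, so the nodes close to the *)
(* pebbles have only boundedly many h-th ancestors altogether.                *)

(** * Relations and cardinals *)

Lemma card_setT_finType (X : finType) : [set: X] #= `I_#|X|.
Proof.
rewrite (card_eqr card_II).
have <- : range (@enum_rank X) = [set: 'I_#|X|].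
  by apply/seteqP; split=> // i _; exists (enum_val i); rewrite ?enum_valK.
by rewrite card_eq_sym; apply: inj_card_eq => x y _ _; apply: enum_rank_inj.
Qed.

Lemma card_leNgt_II (T : Type) (A : set T) n :
  (A #<= `I_n) = ~~ (`I_n.+1 #<= A).
Proof.
have [[m Am]|infA] := pselect (finite_set A).
  by rewrite (card_le_eqr Am) (card_le_eql Am) !card_le_II leqNgt.
have /infiniteP natA := infA.
rewrite (card_le_trans (card_leT _) natA); apply/negP => An.
by apply: infA; apply/finite_set_leP; exists n.
Qed.

Lemma finite_enum (T : Type) (A : set T) m : A #= `I_m ->
  exists2 g : 'I_m -> T, injective g & range g = A.
Proof.
rewrite (card_eqr card_II) card_eq_sym => /card_bijP[f [f' fK f'K]].
pose toT (i : 'I_m) : [set: 'I_m] := SigSub (mem_set (I : [set: 'I_m] i)).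
exists (fun i => val (f (toT i))).
  by move=> i j /val_inj/(can_inj fK)/(congr1 val).
apply/seteqP; split=> [_ [i _ <-]|x Ax]; first exact: set_valP.
pose y : A := SigSub (mem_set Ax); exists (val (f' y)) => //.
have -> : toT (val (f' y)) = f' y by apply: val_inj.
by rewrite f'K.
Qed.

Lemma finite_card_subset_eq (T : Type) (A B : set T) :
  finite_set B -> A `<=` B -> B #<= A -> A = B.
Proof.
move=> finB AB BA; apply/seteqP; split=> // x Bx; apply: contrapT => nAx.
have [n An] := sub_finite_set AB finB.
have : A `|` [set x] #= `I_n.+1.
  apply/eq_cardSP; exists x; first by right.
  rewrite setDUl setDv setU0 (_ : A `\ x = A) //.
  by apply/seteqP; split=> [y []|y Ay] //; split=> // yx; rewrite -yx in nAx.
move=> /card_eqPle[_ nS]; have: `I_n.+1 #<= `I_n.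
  rewrite -(card_le_eqr An); apply: card_le_trans nS (card_le_trans _ BA).
  by apply: subset_card_le => y [/AB|->].
by rewrite card_le_II ltnn.
Qed.

Lemma card_le_fibers (T U I : Type) (f : T -> I) (g : U -> I) (A : set T)
    (B : set U) :
  (forall i, A `&` f @^-1` [set i] #<= B `&` g @^-1` [set i]) -> A #<= B.
Proof.
elim/Ppointed: U => U in g B * => fibers.
  suff -> : A = set0 by [].
  rewrite -subset0 => x Ax; have := fibers (f x).
  by rewrite (empty_eq0 (_ `&` _)) card_le0 => /eqP <-.
have /choice[F FP] : forall i, exists h : T -> U,
    set_fun (A `&` f @^-1` [set i]) (B `&` g @^-1` [set i]) h /\
    {in A `&` f @^-1` [set i] &, injective h}.
  by move=> i; have /pcard_leP/injfunPex[h] := fibers i; exists h.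
apply/pcard_leP/injfunPex; exists (fun x => F (f x) x) => [x Ax|x y].
  by have [/(_ x)[]] := FP (f x).
rewrite !in_setE => Ax Ay Exy; have [funx injx] := FP (f x).
have [_ /= gx] := funx x (conj Ax erefl).
have [_ /= gy] := (FP (f y)).1 y (conj Ay erefl).
have fxy : f x = f y by rewrite -gx Exy gy.
by apply: injx; rewrite ?in_setE ?Exy ?fxy.
Qed.

Lemma relation_invK (T U : Type) (S : set (T * U)) : S^-1^-1 = S.
Proof. by apply/seteqP; split=> -[]. Qed.

Lemma relation_invU1 (T U : Type) (S : set (T * U)) x y :
  (S `|` [set (x, y)])^-1 = S^-1 `|` [set (y, x)].
Proof.
apply/seteqP; split=> -[u v] /= [Suv|[-> ->]]; by [left|right].
Qed.

(** * Distance and ancestors in plane trees *)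

Section Distance.
Variable T : plane_tree.
Implicit Types x y z : T.

Definition adj x y : Prop :=
  (parnt y x \/ parnt x y) \/ (succ y x \/ succ x y).

Lemma adj_sym x y : adj x y -> adj y x.
Proof. by rewrite /adj; tauto. Qed.

Fixpoint within_dist r x y : Prop :=
  if r is r'.+1 then exists z, (x = z \/ adj x z) /\ within_dist r' z y
  else x = y.

Lemma within_dist_refl r x : within_dist r x x.
Proof. by elim: r => //= r IH; exists x; split; [left|]. Qed.

Lemma within_dist_trans r s x y z :
  within_dist r x y -> within_dist s y z -> within_dist (r + s) x z.
Proof.
elim: r x => [|r IH] x /= => [->//|[w [xw wy]] yz].
by exists w; split=> //; apply: IH.
Qed.

Lemma within_dist_leq r s x y :
  r <= s -> within_dist r x y -> within_dist s x y.
Proof.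
by move=> /subnKC <- xy; apply: within_dist_trans xy (within_dist_refl _ _).
Qed.

Lemma adj_within_dist x y : adj x y -> within_dist 1 x y.
Proof. by move=> xy; exists y; split; [right|]. Qed.

Lemma within_dist_sym r x y : within_dist r x y -> within_dist r y x.
Proof.
elim: r x => [|r IH] x /= => [->//|[z [xz /IH zy]]].
case: xz => [->|/adj_sym/adj_within_dist zx]; last first.
  by have := within_dist_trans zy zx; rewrite addn1.
by exists y; split; [left|].
Qed.

(* The root is its own ancestor. *)
Definition ancestor h x : T := iter h (fun y => odflt y (parent y)) x.

Lemma ancestorD i j x : ancestor (i + j) x = ancestor i (ancestor j x).
Proof. exact: iterD. Qed.

Lemma within_dist_ancestor h x : within_dist h (ancestor h x) x.
Proof.
elim: h => //= h IH; exists (ancestor h x); split=> //.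
rewrite /ancestor /=; case E: (parent _) => [z|] /=; [right|by left].
by left; left.
Qed.

Lemma adj_common_ancestor x y : adj x y ->
  exists i j, [/\ i <= 1, j <= 1 & ancestor i x = ancestor j y].
Proof.
have child a b : parnt a b -> ancestor 1 a = b by rewrite /ancestor /= => ->.
have sibling a b : succ a b -> ancestor 1 a = ancestor 1 b.
  by move=> [/sib_lt_sibling[p [/child-> /child->]] _].
case=> [[/child|/child]|[/sibling|/sibling]] E.
- by exists 0, 1.
- by exists 1, 0.
- by exists 1, 1.
- by exists 1, 1.
Qed.

Lemma within_dist_common_ancestor r x y : within_dist r x y ->
  exists i j, [/\ i <= r, j <= r & ancestor i x = ancestor j y].
Proof.
elim: r x => [|r IH] x /=; first by move=> ->; exists 0, 0.
move=> [z [xz /IH [i [j [ir jr Ezy]]]]].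
have [i0 [j0 [i01 j01 Exz]]] : exists i j,
    [/\ i <= 1, j <= 1 & ancestor i x = ancestor j z].
  by case: xz => [->|/adj_common_ancestor//]; exists 0, 0.
exists (i + i0), (j0 + j); split; [lia|lia|].
by rewrite ancestorD Exz -ancestorD addnC ancestorD Ezy -ancestorD.
Qed.

Lemma within_dist_ancestor_of h x y : within_dist h x y ->
  exists j : 'I_(h.*2).+1, ancestor h x = ancestor j y.
Proof.
move=> /within_dist_common_ancestor [i [j [ih jh E]]].
have jP : h - i + j < (h.*2).+1 by lia.
by exists (Ordinal jP); rewrite /= ancestorD -E -ancestorD subnK.
Qed.

Definition near n (e : 'I_n -> T) r x : Prop := exists i, within_dist r (e i) x.

(* [near_ancestors n h] bounds the number of ancestors that nodes at distance *)
(* at most [h] from one of [n] pebbles have [h] levels up.                    *)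
Definition near_ancestors n h := n * (h.*2).+1.

Lemma abundant_far_ancestor n (e : 'I_n -> T) h (A : set T) :
  `I_(near_ancestors n h).+1 #<= A ->
  exists2 u, A u & forall x, ancestor h x = u -> ~ near e h x.
Proof.
move=> many; pose anc (q : 'I_n * 'I_(h.*2).+1) := ancestor q.2 (e q.1).
have [u [Au anc_u]] : exists u, A u /\ ~ range anc u.
  apply: contrapT => none; have /subset_card_le Aanc : A `<=` range anc.
    by move=> u Au; apply: contrapT => anc_u; apply: none; exists u.
  have := card_le_trans many (card_le_trans Aanc (card_image_le _ _)).
  rewrite (card_le_eqr (card_setT_finType _)) card_le_II card_prod !card_ord.
  by rewrite ltnn.
exists u => // x xu [i /within_dist_sym/within_dist_ancestor_of[j xj]].
by apply: anc_u; exists (i, j); rewrite // -xu xj.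
Qed.

End Distance.

(** * Local back-and-forth equivalence *)

Section LocalEquivalence.
Variable c : nat.

Section Game.
Variables T T' : plane_ctree.
Implicit Types S : set (T * T').

(* The constants below [c] count as permanently pebbled. *)
Definition pebbles S : set (option T * option T') :=
  [set (Some q.1, Some q.2) | q in S] `|`
  [set (const T i, const T' i) | i in `I_c].

Definition atom_agree (p q : option T * option T') : Prop :=
  [/\ holds2 eq p.1 q.1 <-> holds2 eq p.2 q.2,
      holds2 (@parnt T) p.1 q.1 <-> holds2 (@parnt T') p.2 q.2 &
      holds2 (@succ T) p.1 q.1 <-> holds2 (@succ T') p.2 q.2].

Definition atoms_agree S : Prop :=
  forall p q, pebbles S p -> pebbles S q -> atom_agree p q.

Definition local_forth (E : set (set (T * T'))) S : Prop :=
  forall a b x, S (a, b) -> adj a x ->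
  exists2 y, adj b y & E (S `|` [set (x, y)]).

Definition local_back (E : set (set (T * T'))) S : Prop :=
  forall a b y, S (a, b) -> adj b y ->
  exists2 x, adj a x & E (S `|` [set (x, y)]).

Fixpoint local_equiv k S : Prop :=
  atoms_agree S /\
  if k is k'.+1 then
    local_forth (local_equiv k') S /\ local_back (local_equiv k') S
  else True.

Lemma local_equiv_atoms k S : local_equiv k S -> atoms_agree S.
Proof. by case: k => [|k] []. Qed.

Lemma pebblesS S S' : S' `<=` S -> pebbles S' `<=` pebbles S.
Proof. by move=> SS'; apply: setSU; apply: image_subset. Qed.

Lemma pebbles_pair S a b : S (a, b) -> pebbles S (Some a, Some b).
Proof. by left; exists (a, b). Qed.

Lemma local_equiv_pair_atoms k S a b a' b' :
  local_equiv k S -> S (a, b) -> S (a', b') ->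
  [/\ a = a' <-> b = b', parnt a a' <-> parnt b b' & succ a a' <-> succ b b'].
Proof.
move=> /local_equiv_atoms agree /pebbles_pair ab /pebbles_pair ab'.
exact: (agree _ _ ab ab').
Qed.

Lemma local_equivW k l S S' :
  k <= l -> S' `<=` S -> local_equiv l S -> local_equiv k S'.
Proof.
have agreeW S1 S2 : S2 `<=` S1 -> atoms_agree S1 -> atoms_agree S2.
  by move=> /pebblesS sub agree p q /sub pS /sub; apply: agree.
elim: k l S S' => [|k IH] [|l] S S' // kl sub [agree moves];
  (split; first exact: agreeW agree) => //.
move: moves => [forth back]; split.
- move=> a b x /sub ab /(forth _ _ _ ab)[y by_ Ey]; exists y => //.
  by apply: IH Ey => //; apply: setSU.
- move=> a b y /sub ab /(back _ _ _ ab)[x ax Ex]; exists x => //.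
  by apply: IH Ex => //; apply: setSU.
Qed.

End Game.

Lemma local_equiv_inv (T T' : plane_ctree) k (S : set (T * T')) :
  local_equiv k S -> local_equiv k S^-1.
Proof.
have pebbles_inv (S0 : set (T * T')) p :
    pebbles S0^-1 p -> pebbles S0 (p.2, p.1).
  case=> [[[b a] ab <-]|[i ic <-]]; first exact: pebbles_pair.
  by right; exists i.
have agree_inv (S0 : set (T * T')) : atoms_agree S0 -> atoms_agree S0^-1.
  move=> agree p q /pebbles_inv pS /pebbles_inv qS.
  by have [? ? ?] := agree _ _ pS qS; split; apply: iff_sym.
elim: k S => [|k IH] S [agree moves]; (split; first exact: agree_inv) => //.
move: moves => [forth back]; split.
- move=> b a y /back/[apply] -[x ax /IH Ex]; exists x => //.
  by rewrite -relation_invU1.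
- move=> b a x /forth/[apply] -[y by_ /IH Ey]; exists y => //.
  by rewrite -relation_invU1.
Qed.

Lemma local_equiv_comp (T T' T'' : plane_ctree) k (S : set (T * T'))
    (S' : set (T' * T'')) :
  local_equiv k S -> local_equiv k S' -> local_equiv k (S' \; S).
Proof.
have agree_comp (S0 : set (T * T')) (S0' : set (T' * T'')) :
    atoms_agree S0 -> atoms_agree S0' -> atoms_agree (S0' \; S0).
  have mid p : pebbles (S0' \; S0) p ->
      exists2 o, pebbles S0 (p.1, o) & pebbles S0' (o, p.2).
    case=> [[q [b /pebbles_pair ? /pebbles_pair ?] <-]|[i ic <-]].
      by exists (Some b).
    by exists (const T' i); right; exists i.
  move=> agree agree' p q /mid[o po op] /mid[o' qo oq].
  have [] := agree _ _ po qo; have [] := agree' _ _ op oq.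
  by rewrite /atom_agree /=; split; tauto.
elim: k S S' => [|k IH] S S' [agree moves] [agree' moves'];
  (split; first exact: agree_comp) => //.
move: moves moves' => [forth back] [forth' back']; split.
- move=> a e x [b /= ab be] /(forth _ _ _ ab)[y /(forth' _ _ _ be)[z ez Ez] Ey].
  exists z => //; apply: local_equivW (IH _ _ Ey Ez) => //.
  move=> p [[b' ? ?]|->]; first by exists b'; left.
  by exists y; right.
- move=> a e z [b /= ab be] /(back' _ _ _ be)[y /(back _ _ _ ab)[x ax Ex] Ey].
  exists x => //; apply: local_equivW (IH _ _ Ex Ey) => //.
  move=> p [[b' ? ?]|->]; first by exists b'; left.
  by exists y; right.
Qed.

Definition node_equiv k (T T' : plane_ctree) (v : T) (v' : T') : Prop :=
  local_equiv k [set (v, v')].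

Lemma node_equiv_sym k (T T' : plane_ctree) (v : T) (v' : T') :
  node_equiv k v v' -> node_equiv k v' v.
Proof. by move=> /local_equiv_inv; apply: local_equivW => // _ ->. Qed.

Lemma node_equiv_trans k (T T' T'' : plane_ctree) (v : T) (v' : T')
    (v'' : T'') :
  node_equiv k v v' -> node_equiv k v' v'' -> node_equiv k v v''.
Proof.
by move=> E /(local_equiv_comp E); apply: local_equivW => // _ ->; exists v'.
Qed.

Section Moves.
Variables T T' : plane_ctree.
Implicit Types S : set (T * T').

Lemma local_equiv_within_dist r k S a b x :
  local_equiv (r + k) S -> S (a, b) -> within_dist r a x ->
  exists2 y, within_dist r b y & local_equiv k (S `|` [set (x, y)]).
Proof.
elim: r S a b => [|r IH] S a b /=.
  move=> E ab <-; exists b => //; apply: local_equivW E => //.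
  by move=> p [//|->].
move=> E ab [z [[<-|az] zx]].
  have [//|y by_ Ey] := IH _ _ _ (local_equivW (leqnSn _) _ E) ab zx.
  by exists y => //; exists b; split; [left|].
have [_ [/(_ _ _ _ ab az)[w bw Ew] _]] := E.
have [|y wy Ey] := IH _ z w Ew _ zx; first by right.
exists y; first by exists w; split; [right|].
by apply: local_equivW Ey => //; apply: setSU => p; left.
Qed.

Definition apart k S1 S2 : Prop := forall a b a' b',
  S1 (a, b) -> S2 (a', b') -> ~ within_dist k a a' /\ ~ within_dist k b b'.

Lemma apart_sym k S1 S2 : apart k S1 S2 -> apart k S2 S1.
Proof.
move=> ap a b a' b' ab ab'; have [na nb] := ap _ _ _ _ ab' ab.
by split=> /within_dist_sym.
Qed.

Lemma apart_adj k S1 S2 a b x y : apart k.+1 S1 S2 -> S1 (a, b) ->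
  adj a x -> adj b y -> apart k (S1 `|` [set (x, y)]) S2.
Proof.
move=> ap ab ax by_ a1 b1 a2 b2 [ab1|[-> ->]] ab2.
  by have [na nb] := ap _ _ _ _ ab1 ab2; split=> /(within_dist_leq (leqnSn k)).
have [na nb] := ap _ _ _ _ ab ab2.
by split=> n2; [apply: na; exists x|apply: nb; exists y]; split=> //; right.
Qed.

Lemma atom_agree_apart (a a' : T) (b b' : T') :
  ~ within_dist 1 a a' -> ~ within_dist 1 b b' ->
  atom_agree (Some a, Some b) (Some a', Some b').
Proof.
have no_atom (T0 : plane_ctree) (x y : T0) : ~ within_dist 1 x y ->
    [/\ ~ x = y, ~ parnt x y & ~ succ x y].
  move=> nxy; split=> xy; apply: nxy.
  - by rewrite xy; apply: within_dist_refl.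
  - by apply: adj_within_dist; left; right.
  - by apply: adj_within_dist; right; right.
by move=> /no_atom[? ? ?] /no_atom[? ? ?]; split; split.
Qed.

Lemma atoms_agree_union S1 S2 : apart 1 S1 S2 ->
  atoms_agree S1 -> atoms_agree S2 -> atoms_agree (S1 `|` S2).
Proof.
move=> ap agree1 agree2.
have cross S S' p q : apart 1 S S' -> atoms_agree S -> atoms_agree S' ->
    pebbles S p -> pebbles S' q -> atom_agree p q.
  move=> apSS' agree agree' pS qS'.
  case: (pS) => [[[a b] ab Ep]|pc]; last by apply: agree' => //; right.
  case: (qS') => [[[a' b'] ab' Eq]|qc]; last by apply: agree => //; right.
  have [] := apSS' _ _ _ _ ab ab'; rewrite -Ep -Eq; exact: atom_agree_apart.
have pebblesU p : pebbles (S1 `|` S2) p -> pebbles S1 p \/ pebbles S2 p.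
  by case=> [[v [vS|vS] <-]|pc]; [left|right|left]; [left; exists v..|right].
move=> p q /pebblesU[p1|p2] /pebblesU[q1|q2]; first exact: agree1.
- exact: (cross S1 S2).
- by apply: (cross S2 S1) => //; apply: apart_sym.
- exact: agree2.
Qed.

Lemma local_equiv_union k S1 S2 : apart k.+1 S1 S2 ->
  local_equiv k S1 -> local_equiv k S2 -> local_equiv k (S1 `|` S2).
Proof.
elim: k S1 S2 => [|k IH] S1 S2 ap E1 E2.
  by split=> //; apply: atoms_agree_union ap (proj1 E1) (proj1 E2).
have extend S S' a b x y : apart k.+2 S S' -> local_equiv k.+1 S' ->
    S (a, b) -> adj a x -> adj b y -> local_equiv k (S `|` [set (x, y)]) ->
    local_equiv k (S `|` S' `|` [set (x, y)]).
  move=> apSS' E' ab ax by_ E; rewrite setUAC; apply: IH E _.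
    exact: apart_adj ab ax by_.
  exact: local_equivW E'.
have extend1 a b x y := extend S1 S2 a b x y ap E2.
have extend2 a b x y : S2 (a, b) -> adj a x -> adj b y ->
    local_equiv k (S2 `|` [set (x, y)]) ->
    local_equiv k (S1 `|` S2 `|` [set (x, y)]).
  by rewrite (setUC S1); apply: extend E1; apply: apart_sym.
move: (E1) (E2) => [agree1 [forth1 back1]] [agree2 [forth2 back2]]; split.
  apply: atoms_agree_union agree1 agree2 => a b a' b' ab ab'.
  have [na nb] := ap _ _ _ _ ab ab'.
  by split=> /(within_dist_leq (ltn0Sn k.+1)).
split=> a b z [ab|ab].
- move=> az; have [y by_ E] := forth1 _ _ _ ab az.
  by exists y => //; apply: (extend1 a b) E.
- move=> az; have [y by_ E] := forth2 _ _ _ ab az.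
  by exists y => //; apply: (extend2 a b) E.
- move=> bz; have [x ax E] := back1 _ _ _ ab bz.
  by exists x => //; apply: (extend1 a b) E.
- move=> bz; have [x ax E] := back2 _ _ _ ab bz.
  by exists x => //; apply: (extend2 a b) E.
Qed.

End Moves.

Lemma node_equiv_forth k (T T' : plane_ctree) (u x : T) (u' : T') :
  node_equiv k.+1 u u' -> adj u x ->
  exists x', [/\ node_equiv k x x', parnt x u <-> parnt x' u' &
                 parnt u x <-> parnt u' x'].
Proof.
move=> [_ [/(_ _ _ x erefl) forth _]] /forth[x' _ E]; exists x'.
have uu' : ([set (u, u')] `|` [set (x, x')]) (u, u') by left.
have xx' : ([set (u, u')] `|` [set (x, x')]) (x, x') by right.
have [_ ? _] := local_equiv_pair_atoms E xx' uu'.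
have [_ ? _] := local_equiv_pair_atoms E uu' xx'.
by split=> //; apply: local_equivW E => // _ ->; right.
Qed.

Lemma node_equiv_child k (T T' : plane_ctree) (u x : T) (u' : T') :
  node_equiv k.+1 u u' -> ancestor 1 x = u ->
  exists2 x', ancestor 1 x' = u' & node_equiv k x x'.
Proof.
rewrite {1}/ancestor /=.
case px: (parent x) => [z|] /= E zu; rewrite -{}zu in E *.
  have [|x' [xx' [/(_ px) px' _] _]] := node_equiv_forth (x := x) E.
    by left; left.
  by exists x'; rewrite // /ancestor /= px'.
exists u'; last exact: local_equivW E.
rewrite /ancestor /=; case pu': (parent u') => [z'|] //=; exfalso.
have [|z [_ _ [/(_ pu')]]] := node_equiv_forth (x := z') (node_equiv_sym E).
  by left; right.
by rewrite /parnt px.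
Qed.

Lemma node_equiv_descendant h k (T T' : plane_ctree) (u : T) (u' : T') x :
  node_equiv (h + k) u u' -> ancestor h x = u ->
  exists2 x', ancestor h x' = u' & node_equiv k x x'.
Proof.
elim: h u u' => [|h IH] u u'; first by rewrite /ancestor /= => E ->; exists u'.
rewrite -add1n ancestorD => /node_equiv_child child /child[y' <-].
by move=> /IH/(_ erefl)[x' <- xx']; exists x'; rewrite // ancestorD.
Qed.

Definition pairing (T T' : plane_ctree) n (e : 'I_n -> T) (e' : 'I_n -> T') :
    set (T * T') :=
  range (fun i => (e i, e' i)).

Lemma pairing_inv (T T' : plane_ctree) n (e : 'I_n -> T) (e' : 'I_n -> T') :
  (pairing e e')^-1 = pairing e' e.
Proof.
apply/seteqP; split=> [[x y] [i _ [<- <-]]|_ [i _ <-]]; by exists i.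
Qed.

Lemma env_cons0 (V : Type) n (v : V) (e : 'I_n -> V) : env_cons v e ord0 = v.
Proof. by rewrite /env_cons unlift_none. Qed.

Lemma env_consS (V : Type) n (v : V) (e : 'I_n -> V) i :
  env_cons v e (lift ord0 i) = e i.
Proof. by rewrite /env_cons liftK. Qed.

Lemma env_cons_eta (V : Type) n (g : 'I_n.+1 -> V) :
  g = env_cons (g ord0) (g \o lift ord0).
Proof.
apply/funext => i; case: (unliftP ord0 i) => [j|] ->.
  by rewrite env_consS.
by rewrite env_cons0.
Qed.

Lemma pairing_cons (T T' : plane_ctree) n (e : 'I_n -> T) (e' : 'I_n -> T')
    x y :
  pairing (env_cons x e) (env_cons y e') = pairing e e' `|` [set (x, y)].
Proof.
apply/seteqP; split=> p.
  case=> i _ <-; case: (unliftP ord0 i) => [j|] ->.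
    by left; exists j; rewrite ?env_consS.
  by right; rewrite !env_cons0.
case=> [[i _ <-]|->].
  by exists (lift ord0 i); rewrite ?env_consS.
by exists ord0; rewrite ?env_cons0.
Qed.

Lemma local_equiv_near_family (T T' : plane_ctree) r k n m (e : 'I_n -> T)
    (e' : 'I_n -> T') (g : 'I_m -> T') :
  (forall j, near e' r (g j)) -> local_equiv (m * r + k) (pairing e e') ->
  exists2 f : 'I_m -> T,
    forall j, near e r (f j) & local_equiv k (pairing e e' `|` pairing f g).
Proof.
elim: m k g => [|m IH] k g gnear E.
  exists (fun=> troot T) => [[]//|]; apply: local_equivW E => //.
  by move=> p [//|[[]]].
have [||f fnear Ef] := IH (r + k) (g \o lift ord0).
- by move=> j; apply: gnear.
- by rewrite addnCA addnA -mulSn.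
have [i eg] := gnear ord0.
have ei : (pairing e e' `|` pairing f (g \o lift ord0))^-1 (e' i, e i).
  by left; exists i.
have [x ex Ex] := local_equiv_within_dist (local_equiv_inv Ef) ei eg.
exists (env_cons x f) => [j|].
  case: (unliftP ord0 j) => [j0|] ->; first by rewrite env_consS.
  by rewrite env_cons0; exists i.
rewrite {1}(env_cons_eta g) pairing_cons setUA.
by move: Ex => /local_equiv_inv; rewrite relation_invU1 relation_invK.
Qed.

Lemma node_equiv_pullback (T T' : plane_ctree) r k n m (e : 'I_n -> T)
    (e' : 'I_n -> T') (u : T) (g : 'I_m -> T') :
  injective g -> (forall j, node_equiv k u (g j)) ->
  (forall j, near e' r (g j)) -> local_equiv (m * r + k) (pairing e e') ->
  exists f : 'I_m -> T,
    [/\ injective f, forall j, node_equiv k (f j) u & forall j, near e r (f j)].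
Proof.
move=> ginj ug gnear /(local_equiv_near_family gnear)[f fnear E]; exists f.
have fg j : (pairing e e' `|` pairing f g) (f j, g j) by right; exists j.
split=> // [i j|j].
  by have [+ _ _] := local_equiv_pair_atoms E (fg i) (fg j) => -> /ginj.
have fj : node_equiv k (f j) (g j) by apply: local_equivW E => // _ ->.
exact: node_equiv_trans fj (node_equiv_sym (ug j)).
Qed.

(** * Local formulas forcing local equivalence *)

Definition local_formula k n (phi : formula n) : Prop :=
  [/\ local phi, qdepth phi <= k & csts_below c phi].

Definition term_index n : finType := ('I_n + 'I_c)%type.

Definition indexed_term n (t : term_index n) : term n :=
  match t with inl i => Var i | inr i => Cst i end.

Definition atom_index n : finType :=
  let pair := (term_index n * term_index n)%type in (pair + pair + pair)%type.

Definition indexed_atom n (x : atom_index n) : formula n :=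
  match x with
  | inl (inl (t, u)) => Equ (indexed_term t) (indexed_term u)
  | inl (inr (t, u)) => Par (indexed_term t) (indexed_term u)
  | inr (t, u) => Suc (indexed_term t) (indexed_term u)
  end.

Lemma local_formula_atom k n (x : atom_index n) :
  local_formula k (indexed_atom x).
Proof.
have below (t : term_index n) : term_below c (indexed_term t) by case: t => /=.
by case: x => [[[t u]|[t u]]|[t u]]; split; rewrite //= ?below //; constructor.
Qed.

Lemma atoms_agree_pairing (T T' : plane_ctree) n (e : 'I_n -> T)
    (e' : 'I_n -> T') :
  (forall x : atom_index n,
     sat (indexed_atom x) e <-> sat (indexed_atom x) e') ->
  atoms_agree (pairing e e').
Proof.
move=> agree; have pebblesP p : pebbles (pairing e e') p ->
    exists t : term_index n,
      p = (eval e (indexed_term t), eval e' (indexed_term t)).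
  case=> [[_ [i _ <-] <-]|[i ic <-]]; first by exists (inl i).
  by exists (inr (Ordinal ic)).
move=> p q /pebblesP[t ->] /pebblesP[u ->]; split.
- exact: (agree (inl (inl (t, u)))).
- exact: (agree (inl (inr (t, u)))).
- exact: (agree (inr (t, u))).
Qed.

Definition literal n (b : bool) (f : formula n) : formula n :=
  if b then f else Imp f Bot.

Definition truth_pattern n (X : finType) (F : X -> formula n)
    (m : {ffun X -> bool}) : formula n :=
  foldr (fun x => And (literal (m x) (F x))) (Imp Bot Bot) (enum X).

Lemma sat_truth_pattern (T : plane_ctree) n (X : finType) (F : X -> formula n)
    (m : {ffun X -> bool}) (e : 'I_n -> T) :
  sat (truth_pattern F m) e <-> forall x, m x <-> sat (F x) e.
Proof.
have sat_literal x : sat (literal (m x) (F x)) e <-> (m x <-> sat (F x) e).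
  by case: (m x) => /=; split=> [|[]]; auto.
transitivity (forall x, x \in enum X -> m x <-> sat (F x) e); last first.
  by split=> mF x *; apply: mF; rewrite ?mem_enum.
rewrite /truth_pattern; elim: (enum X) => [|x s IH] /=; first by split.
rewrite IH sat_literal; split=> [[mx ms] y|ms].
  by rewrite inE => /predU1P[->//|/ms].
by split=> [|y ys]; apply: ms; rewrite inE ?eqxx // ys orbT.
Qed.

Lemma local_formula_truth_pattern k n (X : finType) (F : X -> formula n) m :
  (forall x, local_formula k (F x)) -> local_formula k (truth_pattern F m).
Proof.
move=> localF; rewrite /truth_pattern.
elim: (enum X) => [|x s [locals depths cstss]].
  by split=> //=; do !constructor.
have [localx depthx cstsx] := localF x; split=> /=.
- by constructor=> //; case: (m x) => //=; do !constructor.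
- by rewrite geq_max depths andbT; case: (m x); rewrite //= maxn0.
- by rewrite cstss andbT; case: (m x); rewrite //= andbT.
Qed.

Fixpoint basis_index k n : finType :=
  if k is k'.+1 then
    (atom_index n + 'I_n * {ffun basis_index k' n.+1 -> bool})%type
  else atom_index n.

(* Finitely many formulas of depth [k] force local equivalence: at depth      *)
(* [k.+1] one asks, for each variable z, which truth patterns of the depth-k  *)
(* formulas are realized by some neighbor of z.                               *)
Fixpoint basis k n : basis_index k n -> formula n :=
  match k with
  | 0 => @indexed_atom n
  | k'.+1 => fun x => match x with
    | inl a => indexed_atom a
    | inr (z, m) => ExiNbr z (truth_pattern (@basis k' n.+1) m)
    end
  end.

Lemma local_formula_basis k n (x : basis_index k n) : local_formula k (basis x).
Proof.
elim: k n x => [|k IH] n /=; first exact: local_formula_atom.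
case=> [a|[z m]]; first exact: local_formula_atom.
have [localp depthp cstsp] := local_formula_truth_pattern m (IH n.+1).
by split; [apply: local_ExiNbr|rewrite /= !max0n|].
Qed.

Lemma sat_nbr (T : plane_ctree) n (e : 'I_n -> T) z v :
  sat (nbr z) (env_cons v e) <-> adj (e z) v.
Proof. by rewrite /= env_cons0 env_consS. Qed.

Lemma sat_basis_forth k n (T T' : plane_ctree) (e : 'I_n -> T) (e' : 'I_n -> T')
    z v :
  (forall x : basis_index k.+1 n, sat (basis x) e <-> sat (basis x) e') ->
  adj (e z) v ->
  exists2 v', adj (e' z) v' & forall x : basis_index k n.+1,
    sat (basis x) (env_cons v e) <-> sat (basis x) (env_cons v' e').
Proof.
move=> agree zv.
pose m := [ffun x : basis_index k n.+1 => `[< sat (basis x) (env_cons v e) >]].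
have mP x : m x <-> sat (basis x) (env_cons v e).
  by rewrite ffunE; split=> /asboolP.
have /(agree (inr (z, m))) : sat (basis (inr (z, m) : basis_index k.+1 n)) e.
  by exists v; split; [apply/sat_nbr|apply/sat_truth_pattern].
move=> [v' [/sat_nbr zv' /sat_truth_pattern mv']].
by exists v' => // x; rewrite -mP mv'.
Qed.

Lemma local_equiv_basis k n (T T' : plane_ctree) (e : 'I_n -> T)
    (e' : 'I_n -> T') :
  (forall x : basis_index k n, sat (basis x) e <-> sat (basis x) e') ->
  local_equiv k (pairing e e').
Proof.
elim: k n e e' => [|k IH] n e e' agree.
  by split=> //; apply: atoms_agree_pairing.
split; first by apply: atoms_agree_pairing => a; apply: (agree (inl a)).
split=> _ _ v [z _ [<- <-]] zv.
  have [v' zv' agreev] := sat_basis_forth agree zv.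
  by exists v' => //; rewrite -pairing_cons; apply: IH.
have [v' zv' agreev] := sat_basis_forth (fun x => iff_sym (agree x)) zv.
exists v' => //; rewrite -pairing_cons; apply: IH => x; exact: iff_sym.
Qed.

End LocalEquivalence.

Lemma hintikka_node_equiv D (T T' : plane_ctree) (v : T) (v' : T') :
  hintikka_type D v = hintikka_type D v' -> node_equiv D D v v'.
Proof.
move=> types; have: local_equiv D D (pairing (fun _ : 'I_1 => v) (fun=> v')).
  apply: local_equiv_basis => x.
  have [loc depth csts] := local_formula_basis x.
  have typeP (T0 : plane_ctree) (u : T0) :
      hintikka_type D u (basis x) <-> sat (basis x) (fun=> u).
    by split=> [[]|] //; split; rewrite // /d_formula depth.
  by rewrite -!typeP types.
by apply: local_equivW => // _ ->; exists ord0.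
Qed.

(** * Answering a move by counting types *)

Definition counts_agree (D Gamma : nat) (T T' : plane_ctree) : Prop :=
  forall tau : set (formula 1),
    (nodes_of_type D T tau #= nodes_of_type D T' tau) \/
    ((`I_Gamma #<= nodes_of_type D T tau) /\
     (`I_Gamma #<= nodes_of_type D T' tau)).

Lemma counts_agree_sym D Gamma (T T' : plane_ctree) :
  counts_agree D Gamma T T' -> counts_agree D Gamma T' T.
Proof.
move=> agree tau; case: (agree tau) => [same|[many many']]; last by right.
by left; rewrite card_eq_sym.
Qed.

(* With [n] pebbles placed, a move that leaves depth [k] costs this much: the *)
(* first summand pays for copying a rare class of [k.+1]-st ancestors, the    *)
(* second for a move close to a pebble.                                       *)
Definition lookahead n k : nat :=
  near_ancestors n k.+1 * k.+1.*2 + (k.+1.*2 + k.+1 + k).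

Lemma leq_lookahead n p k : n <= p -> lookahead n k <= lookahead p k.
Proof. by move=> np; rewrite leq_add2r !leq_mul. Qed.

Section Counting.
Variables (D Gamma : nat) (T T' : plane_ctree).
Hypothesis counts : counts_agree D Gamma T T'.

Lemma counts_agree_card_le (A : set T) (A' : set T') :
  (forall v v', hintikka_type D v = hintikka_type D v' -> A v -> A' v') ->
  ~~ (`I_Gamma #<= A') -> A #<= A'.
Proof.
move=> AA' fewA'.
apply: card_le_fibers (@hintikka_type D T) (@hintikka_type D T') _ _ _ => tau.
have [[v [Av vtau]]|noA] := pselect (exists v, A v /\ hintikka_type D v = tau).
  have subA' : nodes_of_type D T' tau `<=` A'.
    by move=> v' v'tau; apply: AA' Av; rewrite vtau v'tau.
  case: (counts tau) => [/card_eqPle[+ _]|[_ many]]; last first.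
    by rewrite (card_le_trans many (subset_card_le subA')) in fewA'.
  move=> /(card_le_trans (subset_card_le (@subIsetr _ _ _))) /card_le_trans.
  by apply; apply: subset_card_le => v' v'tau; split=> //; apply: subA'.
rewrite (_ : A `&` _ = set0) // -subset0 => v [Av vtau].
by apply: noA; exists v.
Qed.

Lemma counts_agree_realize (v : T) : 0 < Gamma ->
  exists v' : T', hintikka_type D v' = hintikka_type D v.
Proof.
move=> Gamma0; apply: contrapT => none.
have T'0 : nodes_of_type D T' (hintikka_type D v) = set0.
  by rewrite -subset0 => v' v'v; apply: none; exists v'.
case: (counts (hintikka_type D v)) => [|[_]]; rewrite T'0.
  by rewrite card_eq0 => /eqP/seteqP[/(_ v erefl)].
by rewrite card_le0 => /eqP/seteqP[/(_ 0 Gamma0)].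
Qed.

(* Copying the class of [u] from T' to the vicinity of the pebbles of T gives *)
(* as many nodes as T has in this class, so [u] itself is one of the copies.  *)
Lemma rare_class_near n (e : 'I_n -> T) (e' : 'I_n -> T') r k N u :
  k <= D -> N < Gamma -> [set u' : T' | node_equiv D k u u'] #<= `I_N ->
  local_equiv D (N * r + k) (pairing e e') ->
  (forall u' : T', node_equiv D k u u' -> near e' r u') -> near e r u.
Proof.
set A' := [set u' | _]; pose A := [set v : T | node_equiv D k v u].
move=> kD NGamma rareA' E A'near.
have finA' : finite_set A' by apply/finite_set_leP; exists N.
have [m A'm] := finA'; have [g ginj gA'] := finite_enum A'm.
have mN : m <= N by rewrite -card_le_II -(card_le_eql A'm).
have ug j : node_equiv D k u (g j).
  by rewrite -[node_equiv _ _ _ _]/(A' _) -gA'; exists j.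
have gnear j : near e' r (g j) by apply: A'near.
have [|f [finj fA fnear]] := node_equiv_pullback (e := e) ginj ug gnear.
  by apply: local_equivW E; rewrite // leq_add2r leq_mul2r mN orbT.
have AA' : A #<= A'.
  apply: counts_agree_card_le => [v v' vv' vu|].
    apply: node_equiv_trans (node_equiv_sym vu) _.
    exact: local_equivW (hintikka_node_equiv vv').
  by apply/negP => /card_le_trans/(_ rareA'); rewrite card_le_II; lia.
have Af : A #<= range f.
  apply: card_le_trans AA' _; rewrite (card_le_eql A'm) (card_le_eql card_II).
  by have /card_eqPle[] := inj_card_eq (A := setT) (fun i j _ _ => @finj i j).
have fsubA : range f `<=` A by move=> _ [j _ <-]; apply: fA.
have finA := card_le_finite AA' finA'.
have : A u := local_equivW kD (@subset_refl _ _) (hintikka_node_equiv erefl).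
by rewrite -(finite_card_subset_eq finA fsubA Af) => -[j _ <-].
Qed.

Lemma node_equiv_far_response n (e : 'I_n -> T) (e' : 'I_n -> T') h k a :
  h + k <= D -> near_ancestors n h < Gamma ->
  local_equiv D (near_ancestors n h * h.*2 + (h + k)) (pairing e e') ->
  ~ near e (h.*2 + h) a ->
  exists2 b : T', node_equiv D k a b & ~ near e' h b.
Proof.
move=> hkD NGamma E afar; pose u := ancestor h a.
have [u' uu' u'far] : exists2 u' : T', node_equiv D (h + k) u u' &
    forall b, ancestor h b = u' -> ~ near e' h b.
  pose A' := [set u' : T' | node_equiv D (h + k) u u'].
  have [|] := boolP (`I_(near_ancestors n h).+1 #<= A').
    exact: abundant_far_ancestor.
  rewrite -card_leNgt_II => rare.
  apply: contrapT => none; apply: afar.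
  suff [i eu] : near e h.*2 u.
    by exists i; apply: within_dist_trans eu (within_dist_ancestor h a).
  apply: rare_class_near rare E _ => // u' uu'.
  apply: contrapT => u'far; apply: none; exists u' => // b bu' [i eb].
  apply: u'far; exists i; rewrite -addnn -bu'.
  exact: within_dist_trans eb (within_dist_sym (within_dist_ancestor h b)).
have [b bu' ab] := node_equiv_descendant uu' (erefl u).
by exists b => //; apply: u'far.
Qed.

Lemma local_equiv_response n (e : 'I_n -> T) (e' : 'I_n -> T') k a :
  lookahead n k <= D -> D < Gamma ->
  local_equiv D (lookahead n k) (pairing e e') ->
  exists b, local_equiv D k (pairing e e' `|` [set (a, b)]).
Proof.
rewrite /lookahead; set h := k.+1; set N := near_ancestors n h.
move=> lookD DGamma E.
have [[i ia]|afar] := pselect (near e (h.*2 + h) a).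
  have ei : pairing e e' (e i, e' i) by exists i.
  have Enear : local_equiv D (h.*2 + h + k) (pairing e e').
    by apply: local_equivW E; rewrite ?leq_addl.
  by have [b _ Eb] := local_equiv_within_dist Enear ei ia; exists b.
have NNh : N <= N * h.*2 by apply: leq_pmulr.
have [|||b ab bfar] :=
    node_equiv_far_response (h := h) (k := k) (e' := e') _ _ _ afar.
- by lia.
- by rewrite -/N; lia.
- by apply: local_equivW E => //; rewrite -/N; lia.
exists b; apply: local_equiv_union ab; last by apply: local_equivW E => //; lia.
move=> _ _ _ _ [i _ [<- <-]] [-> ->]; split=> near_i.
  by apply: afar; exists i; apply: within_dist_leq (leq_addl _ _) near_i.
by apply: bfar; exists i.
Qed.

End Counting.

(** * The global game *)

Section BackAndForth.
Variables (c : nat) (T T' : plane_ctree) (E : nat -> set (set (T * T'))).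
Hypothesis E_atoms : forall q S, E q S -> atoms_agree c S.
Hypothesis E_forth : forall q S a,
  E q.+1 S -> exists b, E q (S `|` [set (a, b)]).
Hypothesis E_back : forall q S b,
  E q.+1 S -> exists a, E q (S `|` [set (a, b)]).

Lemma pebbles_eval n (e : 'I_n -> T) (e' : 'I_n -> T') t :
  term_below c t -> pebbles c (pairing e e') (eval e t, eval e' t).
Proof.
case: t => [i _|i ic]; last by right; exists i.
by left; exists (e i, e' i) => //; exists i.
Qed.

Lemma back_and_forth_sat n (phi : formula n) q (e : 'I_n -> T)
    (e' : 'I_n -> T') :
  csts_below c phi -> qdepth phi <= q -> E q (pairing e e') ->
  sat phi e <-> sat phi e'.
Proof.
elim: phi q e e' => {n} [n|n t u|n t u|n t u|n f IHf g IHg|n f IHf g IHg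
  |n f IHf g IHg|n f IH|n f IH] q e e' /=.
- by [].
1-3: by move=> /andP[/(pebbles_eval e e') te /(pebbles_eval e e') ue] _;
  move=> /E_atoms /(_ _ _ te ue)[].
1-3: rewrite geq_max => /andP[cf cg] /andP[fq gq] Eq.
1-3: by rewrite (IHf q _ _ cf fq Eq) (IHg q _ _ cg gq Eq).
all: case: q => // q cf fq Eq.
all: have {}IH v w := IH q (env_cons v e) (env_cons w e') cf fq.
all: have forth v := E_forth v Eq; have back w := E_back w Eq.
- split=> sat_f v; [have [w] := back v|have [w] := forth v];
    by rewrite -pairing_cons => /IH IHvw; apply/IHvw.
- split=> -[v sat_f]; [have [w] := forth v|have [w] := back v];
    by rewrite -pairing_cons => /IH IHvw; exists w; apply/IHvw.
Qed.

End BackAndForth.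

Definition game_depth p q : nat := iter q (lookahead p) 0.

Lemma leq_game_depth p : {homo game_depth p : q r / q <= r}.
Proof.
apply: homo_leq leqnn leq_trans _ => q.
by rewrite /game_depth iterS /lookahead; lia.
Qed.

(* [p] bounds the number of pebbles at the end of the game, of which [q] are  *)
(* still to be placed.                                                        *)
Definition game_equiv D p q (T T' : plane_ctree) : set (set (T * T')) :=
  [set S | exists n (e : 'I_n -> T) (e' : 'I_n -> T'),
     [/\ n + q <= p, S = pairing e e' & local_equiv D (game_depth p q) S]].

Lemma game_equiv_inv D p q (T T' : plane_ctree) (S : set (T * T')) :
  game_equiv D p q S -> game_equiv D p q S^-1.
Proof.
move=> [n [e [e' [npq -> E]]]]; exists n, e', e.
by split; [|rewrite pairing_inv|apply: local_equiv_inv].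
Qed.

Lemma game_equiv_forth D Gamma p q (T T' : plane_ctree) (S : set (T * T')) a :
  counts_agree D Gamma T T' -> game_depth p p <= D -> D < Gamma ->
  game_equiv D p q.+1 S -> exists b, game_equiv D p q (S `|` [set (a, b)]).
Proof.
move=> counts depthD DGamma [n [e [e' [npq -> E]]]].
have look_depth : lookahead n (game_depth p q) <= game_depth p q.+1.
  by apply: leq_lookahead; lia.
have depth_p : game_depth p q.+1 <= game_depth p p.
  by apply: leq_game_depth; lia.
have lookD := leq_trans look_depth (leq_trans depth_p depthD).
have [|b Eb] := local_equiv_response (e := e) (e' := e') counts a lookD DGamma.
  exact: local_equivW E.
exists b, n.+1, (env_cons a e), (env_cons b e').
by rewrite addSnnS pairing_cons.
Qed.

Lemma game_equiv_back D Gamma p q (T T' : plane_ctree) (S : set (T * T')) b :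
  counts_agree D Gamma T T' -> game_depth p p <= D -> D < Gamma ->
  game_equiv D p q.+1 S -> exists a, game_equiv D p q (S `|` [set (a, b)]).
Proof.
move=> /counts_agree_sym counts depthD DGamma /game_equiv_inv.
move=> /(game_equiv_forth b counts depthD DGamma)[a /game_equiv_inv].
by rewrite relation_invU1 relation_invK; exists a.
Qed.

Lemma counts_agree_sat D Gamma (T T' : plane_ctree) p q n (phi : formula n)
    (e : 'I_n -> T) (e' : 'I_n -> T') :
  counts_agree D Gamma T T' -> game_depth p p <= D -> D < Gamma ->
  csts_below D phi -> qdepth phi <= q -> n + q <= p ->
  local_equiv D (game_depth p q) (pairing e e') -> sat phi e <-> sat phi e'.
Proof.
move=> counts depthD DGamma csts depth npq E.
apply: (back_and_forth_sat (E := fun q => @game_equiv D p q T T')) csts depth _.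
- by move=> r _ [m [f [f' [_ -> /local_equiv_atoms]]]].
- by move=> r S a; apply: game_equiv_forth counts depthD DGamma.
- by move=> r S b; apply: game_equiv_back counts depthD DGamma.
- by exists n, e, e'.
Qed.

Lemma csts_belowW c d n (phi : formula n) :
  c <= d -> csts_below c phi -> csts_below d phi.
Proof.
move=> cd; have term_belowW m (t : term m) : term_below c t -> term_below d t.
  by case: t => //= i; lia.
by elim: phi => //= {}n => [t u|t u|t u|f IHf g IHg|f IHf g IHg|f IHf g IHg]
  /andP[] => *; apply/andP; auto.
Qed.

Lemma counts_agree_d_sentences d D Gamma (T T' : plane_ctree) :
  counts_agree D Gamma T T' -> d <= D -> game_depth d d <= D -> D < Gamma ->
  d_sentences d T `<=` d_sentences d T'.
Proof.
move=> counts dD depthD DGamma phi [dphi Tphi]; split=> // e'.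
have /andP[depth csts] := dphi; pose e : 'I_0 -> T := fun=> troot T.
have cstsD := csts_belowW dD csts.
apply/(counts_agree_sat (e := e) counts depthD DGamma cstsD depth) => //.
have Gamma0 : 0 < Gamma by apply: leq_ltn_trans DGamma.
have [v' v'root] := counts_agree_realize counts (troot T) Gamma0.
by apply: local_equivW (hintikka_node_equiv (esym v'root)) => // p [[]].
Qed.

Theorem theorem7 (d : nat) :
  exists D Gamma : nat, forall T T' : plane_ctree,
    (forall tau : set (formula 1),
       (nodes_of_type D T tau #= nodes_of_type D T' tau) \/
       ((`I_Gamma #<= nodes_of_type D T tau) /\
        (`I_Gamma #<= nodes_of_type D T' tau))) ->
    d_sentences d T = d_sentences d T'.
Proof.
pose D := d + game_depth d d.
exists D, D.+1 => T T' counts.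
have sub (T1 T2 : plane_ctree) : counts_agree D D.+1 T1 T2 ->
    d_sentences d T1 `<=` d_sentences d T2.
  by move=> counts12; apply: counts_agree_d_sentences counts12 _ _ _; lia.
by apply/seteqP; split; apply: sub => //; apply: counts_agree_sym.
Qed.
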